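(* Let $T\in\mathbb{R}^{n\times n}$ be a banded matrix with $p$ subdiagonals and $q$ superdiagonals ($0\le p,q\le n$). Then $T$ is banded totally positive, i.e. all its nontrivial minors are positive, if and only if all its nontrivial initial minors are positive.
   Context: Rows and columns are labelled $1,\dots,n$. A matrix $T\in\mathbb{R}^{n\times n}$ belongs to $B_{p,q}$ (banded with $p$ subdiagonals and $q$ superdiagonals) if $T_{i,j}=0$ whenever $j>i+q$ or $i>j+p$. For increasing sequences $i_1<\dots<i_r$ and $j_1<\dots<j_r$ in $\{1,\dots,n\}$, the associated submatrix has entries $(T_{i_k,j_l})_{k,l=1}^r$ and the associated minor is its determinant. For $T\in B_{p,q}$ the submatrix (and its minor) is called trivial (with respect to $(p,q)$) if there is $k\in\{1,\dots,r\}$ such that $j_k>i_k+q$ or $i_k>j_k+p$; otherwise it is nontrivial. A minor is initial if either its rows are $1,2,\dots,r$ and its columns are $j,j+1,\dots,j+r-1$ for some $j$, or its rows are $i,i+1,\dots,i+r-1$ for some $i$ and its columns are $1,2,\dots,r$. A matrix $T\in B_{p,q}$ is banded totally positive if all its nontrivial minors are positive. *)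

(* Defs.v *)
From mathcomp Require Import all_boot all_order all_algebra.
From mathcomp Require Import reals.

Set Implicit Arguments.
Unset Strict Implicit.
Unset Printing Implicit Defensive.

Import Order.TTheory GRing.Theory Num.Theory.

Local Open Scope ring_scope.

(* Rows and columns are indexed from 0. Every band and triviality condition
   compares a row index with a column index, so it is the same as in the
   1-based convention. *)

Definition banded (R : realType) (n p q : nat) (T : 'M[R]_n) : Prop :=
  forall i j : 'I_n, (i + q < j)%N \/ (j + p < i)%N -> T i j = 0.

Definition increasing (r n : nat) (f : 'I_r -> 'I_n) : Prop :=
  forall k l : 'I_r, (k < l)%N -> (f k < f l)%N.

Definition minor (R : realType) (n r : nat) (T : 'M[R]_n)
    (f g : 'I_r -> 'I_n) : R :=
  \det (mxsub f g T).

Definition trivial_minor (n r p q : nat) (f g : 'I_r -> 'I_n) : Prop :=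
  exists k : 'I_r, (f k + q < g k)%N \/ (g k + p < f k)%N.

Definition consecutive_from (n r s : nat) (f : 'I_r -> 'I_n) : Prop :=
  forall k : 'I_r, f k = (s + k)%N :> nat.

Definition initial_minor (n r : nat) (f g : 'I_r -> 'I_n) : Prop :=
  (consecutive_from 0 f /\ exists j : nat, consecutive_from j g) \/
  ((exists i : nat, consecutive_from i f) /\ consecutive_from 0 g).

Definition nontrivial_minors_pos (R : realType) (n p q : nat)
    (T : 'M[R]_n) : Prop :=
  forall (r : nat) (f g : 'I_r -> 'I_n),
    (0 < r)%N -> increasing f -> increasing g ->
    ~ trivial_minor p q f g -> 0 < minor T f g.

Definition nontrivial_initial_minors_pos (R : realType) (n p q : nat)
    (T : 'M[R]_n) : Prop :=
  forall (r : nat) (f g : 'I_r -> 'I_n),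
    (0 < r)%N -> increasing f -> increasing g -> initial_minor f g ->
    ~ trivial_minor p q f g -> 0 < minor T f g.

Definition banded_totally_positive (R : realType) (n p q : nat)
    (T : 'M[R]_n) : Prop :=
  banded p q T /\ nontrivial_minors_pos p q T.

(* Main.v *)
(** One step of Neville elimination on the rows and then on the columns writes
    T = L (t + S) U (direct sum, t the corner entry of T), where L and U are
    unit lower and upper triangular with nonnegative bidiagonal factors. The
    matrix S is smaller, has the same band, and each of its initial minors is a
    quotient of the next larger initial minor of T by an entry of the first row
    or column of T, so S satisfies the hypothesis and induction applies.
    Conversely, T is recovered from t + S by repeatedly adding a nonnegative
    multiple of a row (column) to the next one; by multilinearity every minor of
    T is then a nonnegative combination of minors of t + S. For a nontrivial
    minor one term is positive: it is obtained by moving the first row or column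
    index down to the first position, which only uses multipliers inside the
    band, and these are positive. *)
Require Import Defs.
From mathcomp Require Import all_boot all_order all_algebra.
From mathcomp Require Import reals.
From mathcomp Require Import perm zify ring.

Set Implicit Arguments.
Unset Strict Implicit.
Unset Printing Implicit Defensive.

Import Order.TTheory GRing.Theory Num.Theory.

Local Open Scope ring_scope.

(** Clamped predecessor: [ordp ord0] is [ord0], and the row recursions below give [ord0] the
    multiplier 0. *)
Definition ordp (n : nat) (i : 'I_n.+1) : 'I_n.+1 := inord i.-1.

Lemma val_ordp (n : nat) (i : 'I_n.+1) : ordp i = i.-1 :> nat.
Proof. by rewrite inordK // (leq_ltn_trans (leq_pred _)). Qed.

Section Minors.
Variable R : realType.
Implicit Types n r p q : nat.

(** * Transposition and vanishing of trivial minors *)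

Lemma eq_minor n r (M : 'M[R]_n) (f f' g g' : 'I_r -> 'I_n) :
  f =1 f' -> g =1 g' -> minor M f g = minor M f' g'.
Proof.
by move=> ef eg; congr (\det _); apply/matrixP=> i j; rewrite !mxE ef eg.
Qed.

Lemma minor_tr n r (M : 'M[R]_n) (f g : 'I_r -> 'I_n) :
  minor M^T g f = minor M f g.
Proof. by rewrite /minor -det_tr; congr (\det _); apply/matrixP=> i j; rewrite !mxE. Qed.

Lemma banded_tr n p q (M : 'M[R]_n) : banded p q M -> banded q p M^T.
Proof. by move=> bM i j h; rewrite mxE; apply: bM; case: h; [right|left]. Qed.

Lemma trivial_minor_sym n r p q (f g : 'I_r -> 'I_n) :
  trivial_minor p q f g -> trivial_minor q p g f.
Proof. by case=> k [h|h]; exists k; [right|left]. Qed.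

Lemma increasing_le n r (f : 'I_r -> 'I_n) (k l : 'I_r) :
  increasing f -> (k <= l)%N -> (f k <= f l)%N.
Proof.
move=> incf; rewrite leq_eqVlt => /orP[/eqP/val_inj ->|/incf /ltnW] //.
Qed.

(* A permutation cannot map [0, k] into [0, k), so every Leibniz term meets
   the zero block with rows [0, k] and columns [k, r). *)
Lemma trivial_minor_eq0 n r p q (M : 'M[R]_n) (f g : 'I_r -> 'I_n) :
  banded p q M -> increasing f -> increasing g ->
  trivial_minor p q f g -> minor M f g = 0.
Proof.
wlog suff upper : p q M f g / banded p q M -> increasing f -> increasing g ->
    (exists k, (f k + q < g k)%N) -> minor M f g = 0.
  move=> bM incf incg [k [h|h]]; first by apply: (upper p q) => //; exists k.
  by rewrite -minor_tr; apply: (upper q p) => //; [exact: banded_tr | exists k].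
move=> bM incf incg [k fgk]; apply: big1 => s _.
have [a ak ska] : exists2 a : 'I_r, (a <= k)%N & (k <= s a)%N.
  apply/exists_inP; apply: contraT; rewrite negb_exists_in => /forall_inP sk.
  have sub : [set s x | x in [set a : 'I_r | (a <= k)%N]]
               \subset [set a : 'I_r | (a <= k)%N] :\ k.
    apply/subsetP=> y /imsetP[x]; rewrite !inE => /sk; rewrite -ltnNge => lt ->.
    by rewrite (ltnW lt) andbT -val_eqE /= ltn_eqF.
  have := subset_leq_card sub; rewrite card_imset; last exact: perm_inj.
  by rewrite [X in (X <= _)%N](cardsD1 k) inE leqnn ltnn.
rewrite (bigD1 a) //= !mxE bM ?mul0r ?mulr0 //; left.
have := increasing_le incf ak; have := increasing_le incg ska; lia.
Qed.

(** * Total nonnegativity *)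

Definition nondecreasing n r (f : 'I_r -> 'I_n) : Prop :=
  forall k l : 'I_r, (k <= l)%N -> (f k <= f l)%N.

(* Allowing repeated indices, for which the minor vanishes, lets an index of a
   minor be lowered without checking that it stays distinct from the others. *)
Definition totally_nonnegative n (M : 'M[R]_n) : Prop :=
  forall r (f g : 'I_r -> 'I_n),
    nondecreasing f -> nondecreasing g -> 0 <= minor M f g.

Lemma nondecreasing_increasing_or_minor0 n r (M : 'M[R]_n) (f g : 'I_r -> 'I_n) :
  nondecreasing f -> increasing f \/ minor M f g = 0.
Proof.
move=> ndf.
have [|] := boolP [forall k : 'I_r, forall l : 'I_r, (k < l)%N ==> (f k < f l)%N].
  by move=> /'forall_'forall_implyP h; left.
rewrite negb_forall => /existsP[k]; rewrite negb_forall => /existsP[l].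
rewrite negb_imply -leqNgt => /andP[kl flk]; right.
apply: (@determinant_alternate _ _ _ k l) => [|j]; first by rewrite -val_eqE /= ltn_eqF.
rewrite !mxE; congr (M _ _); apply/val_inj/eqP.
by rewrite eqn_leq flk andbT ndf // ltnW.
Qed.

Lemma totally_nonnegative_increasing n (M : 'M[R]_n) :
  (forall r (f g : 'I_r -> 'I_n),
     increasing f -> increasing g -> 0 <= minor M f g) ->
  totally_nonnegative M.
Proof.
move=> h r f g ndf ndg.
have [incf|->] // := nondecreasing_increasing_or_minor0 M g ndf.
have [incg|] := nondecreasing_increasing_or_minor0 M^T f ndg; first exact: h.
by rewrite minor_tr => ->.
Qed.

Lemma totally_nonnegative_tr n (M : 'M[R]_n) :
  totally_nonnegative M -> totally_nonnegative M^T.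
Proof. by move=> tM r f g ndf ndg; rewrite minor_tr; apply: tM. Qed.

(** * Row additions and bidiagonal factors *)

Definition upd n r (f : 'I_r -> 'I_n) (x : 'I_r) (a : 'I_n) : 'I_r -> 'I_n :=
  fun y => if y == x then a else f y.

(** Multilinearity in row [x]; since [f] is increasing, the modified row [k] is selected only
    there. *)
Lemma minor_add_row n r (M M' : 'M[R]_n) (k l : 'I_n) (c : R)
    (f g : 'I_r -> 'I_n) (x : 'I_r) :
  (forall i j, i != k -> M' i j = M i j) ->
  (forall j, M' k j = M k j + c * M l j) ->
  increasing f -> f x = k ->
  minor M' f g = minor M f g + c * minor M (upd f x l) g.
Proof.
move=> eqM eqMk incf fx.
rewrite -[minor M f g]mul1r; apply: (determinant_multilinear (i0 := x)).
- by apply/rowP=> j; rewrite !mxE /upd eqxx fx eqMk mul1r.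
- apply/matrixP=> i j; rewrite !mxE eqM //.
  apply/eqP=> fi; have := neq_lift x i; rewrite -val_eqE neq_ltn.
  by case/orP=> /incf; rewrite fx fi ltnn.
- apply/matrixP=> i j; rewrite !mxE /upd eq_sym (negPf (neq_lift x i)) eqM //.
  apply/eqP=> fi; have := neq_lift x i; rewrite -val_eqE neq_ltn.
  by case/orP=> /incf; rewrite fx fi ltnn.
Qed.

(** The recursion uses a row of [M], not of [N]: rows are updated from the top down, each from the
    already updated row above it. *)
Definition bidiag n (c : 'I_n.+1 -> R) (N M : 'M[R]_n.+1) : Prop :=
  c ord0 = 0 /\ forall i j, M i j = N i j + c i * M (ordp i) j.

(** [N = L *m M] with [L] unit lower bidiagonal, hence of determinant 1. *)
Lemma det_bidiag n (c : 'I_n.+1 -> R) (N M : 'M[R]_n.+1) :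
  bidiag c N M -> \det M = \det N.
Proof.
move=> [c0 eqM].
pose L := \matrix_(i, j) ((i == j)%:R - c i * (j == ordp i)%:R).
have eqN : N = L *m M.
  apply/matrixP=> i j; rewrite mxE (eq_bigr (fun k =>
    (i == k)%:R * M k j - c i * ((k == ordp i)%:R * M k j))); last first.
    by move=> k _; rewrite mxE mulrBl mulrA.
  rewrite sumrB -mulr_sumr (bigD1 i) //= [X in _ - _ * X](bigD1 (ordp i)) //=.
  rewrite !eqxx !mul1r !big1 ?addr0; first by rewrite (eqM i) addrK.
    by move=> k /negPf ->; rewrite mul0r.
  by move=> k; rewrite eq_sym => /negPf ->; rewrite mul0r.
have L1 (i : 'I_n.+1) : L i i = 1.
  rewrite mxE eqxx; have [->|/negPf nz] := eqVneq i ord0; first by rewrite c0 mul0r subr0.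
  suff /negPf -> : i != ordp i by rewrite mulr0 subr0.
  move: nz; rewrite -!val_eqE /= val_ordp; lia.
rewrite eqN det_mulmx det_trig; last first.
  apply/is_trig_mxP=> i j ij; rewrite mxE -!val_eqE /= val_ordp.
  have -> : (i == j :> nat) = false by lia.
  have -> : (j == i.-1 :> nat) = false by lia.
  by rewrite mulr0 subr0.
by rewrite big1 ?mul1r // => i _; apply: L1.
Qed.

Section Hybrid.
Variables (n : nat) (c : 'I_n.+1 -> R) (N M : 'M[R]_n.+1).
Hypotheses (NM : bidiag c N M) (c_ge0 : forall i, 0 <= c i).
Hypothesis tN : totally_nonnegative N.

(* Interpolates between N (k = 0) and M (k = n); each increment of k adds a
   multiple of a row to the next one. *)
Definition hybrid (k : nat) : 'M[R]_n.+1 :=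
  \matrix_(i, j) if (i <= k)%N then M i j else N i j.

Lemma hybrid0 : hybrid 0 = N.
Proof.
case: NM => c0 eqM; apply/matrixP=> i j; rewrite mxE leqn0.
case: eqP => // /eqP i0; have -> : i = ord0 by apply/val_inj/eqP.
by rewrite eqM c0 mul0r addr0.
Qed.

Lemma hybrid_last k : (n <= k)%N -> hybrid k = M.
Proof.
by move=> nk; apply/matrixP=> i j; rewrite mxE (leq_trans _ nk) // -ltnS.
Qed.

Lemma minor_hybrid_skip k r (f g : 'I_r -> 'I_n.+1) :
  (forall x, f x != k.+1 :> nat) -> minor (hybrid k.+1) f g = minor (hybrid k) f g.
Proof.
move=> nf; congr (\det _); apply/matrixP=> x y; rewrite !mxE.
by rewrite leq_eqVlt (negPf (nf x)).
Qed.

Lemma minor_hybrid_move k r (f g : 'I_r -> 'I_n.+1) (x : 'I_r) :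
  increasing f -> f x = k.+1 :> nat ->
  minor (hybrid k.+1) f g =
  minor (hybrid k) f g + c (f x) * minor (hybrid k) (upd f x (ordp (f x))) g.
Proof.
move=> incf fx; apply: (@minor_add_row _ _ _ _ (f x)) => // [i j ne|j]; rewrite !mxE.
  by rewrite leq_eqVlt ltnS -fx val_eqE (negPf ne).
by rewrite val_ordp fx !leqnn ltnn; case: NM => _ ->.
Qed.

Lemma nondecreasing_upd_ordp r (f : 'I_r -> 'I_n.+1) (x : 'I_r) :
  increasing f -> nondecreasing (upd f x (ordp (f x))).
Proof.
move=> incf k l kl; rewrite /upd.
case: eqVneq => [ek|nk]; case: eqVneq => [el|nl] //.
- rewrite val_ordp; have := increasing_le incf kl; rewrite ek; lia.
- rewrite val_ordp; suff /incf : (k < l)%N by rewrite el; lia.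
  by rewrite ltn_neqAle kl andbT el.
- exact: increasing_le.
Qed.

Lemma hybrid_totally_nonnegative k : totally_nonnegative (hybrid k).
Proof.
elim: k => [|k IHk]; first by rewrite hybrid0.
apply: totally_nonnegative_increasing => r f g incf incg.
have [ndf ndg] : nondecreasing f /\ nondecreasing g.
  by split=> a b; apply: increasing_le.
have [/existsP[x /eqP fx]|] := boolP [exists x, f x == k.+1 :> nat].
  rewrite (minor_hybrid_move _ incf fx) addr_ge0 ?IHk // mulr_ge0 // IHk //.
  exact: nondecreasing_upd_ordp.
by rewrite negb_exists => /forallP nf; rewrite minor_hybrid_skip // IHk.
Qed.

Lemma minor_hybrid_mono k m r (f g : 'I_r -> 'I_n.+1) :
  increasing f -> increasing g -> (k <= m)%N ->
  minor (hybrid k) f g <= minor (hybrid m) f g.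
Proof.
move=> incf incg /subnKC <-; elim: (m - k)%N => [|d IHd]; first by rewrite addn0.
rewrite addnS (le_trans IHd) //; set j := (k + d)%N.
have [/existsP[x /eqP fx]|] := boolP [exists x, f x == j.+1 :> nat].
  rewrite (minor_hybrid_move _ incf fx) lerDl mulr_ge0 //.
  apply: hybrid_totally_nonnegative; first exact: nondecreasing_upd_ordp.
  by move=> a b; apply: increasing_le.
by rewrite negb_exists => /forallP nf; rewrite minor_hybrid_skip.
Qed.

Lemma increasing_upd_first r (f : 'I_r.+1 -> 'I_n.+1) (a : 'I_n.+1) :
  increasing f -> (a <= f ord0)%N -> increasing (upd f ord0 a).
Proof.
move=> incf af k l kl; rewrite /upd.
have /negPf -> : l != ord0 by rewrite -val_eqE /=; lia.
case: eqVneq => [ek|_]; last exact: incf.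
by apply: leq_ltn_trans af _; apply: incf; rewrite -ek.
Qed.

(** The first index has no smaller index to collide with, so it descends from [a] to 0 one row per
    stage. Each stage multiplies by a positive [c i] and drops a nonnegative summand. *)
Lemma minor_hybrid_gt0 a r (f g : 'I_r.+1 -> 'I_n.+1) :
  increasing f -> increasing g -> f ord0 = a :> nat ->
  (forall i : 'I_n.+1, (0 < i <= a)%N -> 0 < c i) ->
  0 < minor N (upd f ord0 ord0) g -> 0 < minor (hybrid a) f g.
Proof.
elim: a f => [|a IHa] f incf incg fa c_gt0 Npos.
  rewrite hybrid0 (eq_minor _ (f' := upd f ord0 ord0) (g' := g)) // => x.
  by rewrite /upd; case: eqP => // ->; apply/val_inj.
rewrite (minor_hybrid_move _ incf fa) ltr_wpDl //.
  by apply: hybrid_totally_nonnegative => k l; apply: increasing_le.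
rewrite mulr_gt0 ?c_gt0 ?fa ?leqnn // IHa //.
- by apply: increasing_upd_first; rewrite ?val_ordp ?leq_pred.
- by rewrite /upd eqxx val_ordp fa.
- by move=> i /andP[i0 ia]; rewrite c_gt0 // i0 leqW.
- rewrite (eq_minor _ (f' := upd f ord0 ord0) (g' := g)) // => x.
  by rewrite /upd; case: eqP.
Qed.

Lemma bidiag_totally_nonnegative : totally_nonnegative M.
Proof. by rewrite -(hybrid_last (leqnn n)); apply: hybrid_totally_nonnegative. Qed.

Lemma minor_bidiag_le r (f g : 'I_r -> 'I_n.+1) :
  increasing f -> increasing g -> minor N f g <= minor M f g.
Proof.
by move=> incf incg; rewrite -hybrid0 -(hybrid_last (leqnn n)) minor_hybrid_mono.
Qed.

Lemma minor_bidiag_gt0 r (f g : 'I_r.+1 -> 'I_n.+1) :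
  increasing f -> increasing g ->
  (forall i : 'I_n.+1, (0 < i <= f ord0)%N -> 0 < c i) ->
  0 < minor N (upd f ord0 ord0) g -> 0 < minor M f g.
Proof.
move=> incf incg c_gt0 Npos.
rewrite -(hybrid_last (leqnn n)).
have fn : (f ord0 <= n)%N by rewrite -ltnS.
(* Stage [f ord0] already makes the minor positive; later stages can only increase it. *)
by apply: lt_le_trans (minor_hybrid_mono incf incg fn); apply: minor_hybrid_gt0.
Qed.

End Hybrid.


Lemma minor_empty n (M : 'M[R]_n) (f g : 'I_0 -> 'I_n) : minor M f g = 1.
Proof. exact: det_mx00. Qed.

Lemma det_first_col n (A : 'M[R]_n.+1) :
  (forall k, k != ord0 -> A k ord0 = 0) ->
  \det A = A ord0 ord0 * \det (mxsub (lift ord0) (lift ord0) A).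
Proof.
move=> A0; rewrite (expand_det_col A ord0) big_ord_recl big1 ?addr0 => [|k _].
  rewrite /cofactor expr0 mul1r; congr (_ * \det _).
  by apply/matrixP=> i j; rewrite !mxE.
by rewrite A0 ?mul0r // eq_sym neq_lift.
Qed.

(** * One step of Neville elimination *)

Section NevilleStep.
Variable n : nat.
Implicit Types (M : 'M[R]_n.+1) (i j : 'I_n.+1).

(** Below the band this may be 0 / 0, which is 0 by the convention for division. *)
Definition ratio M i : R :=
  if i == ord0 then 0 else M i ord0 / M (ordp i) ord0.

Definition neville M : 'M[R]_n.+1 :=
  \matrix_(i, j) (M i j - ratio M i * M (ordp i) j).

Definition first_col_positive p M : Prop :=
  forall i, ((i <= p)%N -> 0 < M i ord0) /\ ((p < i)%N -> M i ord0 = 0).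

Lemma bidiag_neville M : bidiag (ratio M) (neville M) M.
Proof. by split=> [|i j]; rewrite /ratio ?eqxx // mxE subrK. Qed.

Lemma neville_row0 M j : neville M ord0 j = M ord0 j.
Proof. by rewrite mxE /ratio eqxx mul0r subr0. Qed.

Lemma neville_col0 p M i :
  first_col_positive p M -> i != ord0 -> neville M i ord0 = 0.
Proof.
move=> Mp i0; rewrite mxE /ratio (negPf i0).
have [z|nz] := eqVneq (M (ordp i) ord0) 0; last by rewrite divfK ?subrr.
(* A zero pivot lies below the band, and so does the entry under it. *)
rewrite z mulr0 subr0; apply: (Mp i).2; rewrite ltnNge; apply/negP=> ip.
suff : 0 < M (ordp i) ord0 by rewrite z ltxx.
by apply: (Mp _).1; rewrite val_ordp (leq_trans (leq_pred _) ip).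
Qed.

Lemma ratio_gt0 p M i : first_col_positive p M -> (0 < i <= p)%N -> 0 < ratio M i.
Proof.
move=> Mp /andP[i0 ip]; have /negPf i0' : i != ord0 by rewrite -val_eqE /= -lt0n.
rewrite /ratio i0' divr_gt0 ?(Mp _).1 // val_ordp.
exact: leq_trans (leq_pred _) ip.
Qed.

Lemma ratio_eq0 p M i : first_col_positive p M -> (p < i)%N -> ratio M i = 0.
Proof. by move=> Mp pi; rewrite /ratio (Mp i).2 // mul0r if_same. Qed.

Lemma ratio_ge0 p M i : first_col_positive p M -> 0 <= ratio M i.
Proof.
move=> Mp; have [i0|] := posnP i; last first.
  move=> i0; have [ip|pi] := leqP i p; last by rewrite (ratio_eq0 Mp).
  by rewrite ltW // (ratio_gt0 Mp) // i0.
by rewrite /ratio -val_eqE /= i0.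
Qed.

(** Row [ordp i] reaches one column further left than row [i] may. This matters only when [p < i],
    and then the multiplier is 0. *)
Lemma banded_neville p q M :
  first_col_positive p M -> banded p q M -> banded p q (neville M).
Proof.
move=> Mp bM i j h; rewrite mxE bM // sub0r.
have [pi|ip] := ltnP p i; first by rewrite (ratio_eq0 Mp) // mul0r oppr0.
rewrite bM ?mulr0 ?oppr0 // val_ordp; lia.
Qed.

(** Row elimination keeps the first row, which determines the column multipliers, and symmetrically;
    with the same multipliers, row and column operations commute. *)
Lemma neville_tr_comm M : (neville (neville M)^T)^T = neville (neville M^T)^T.
Proof.
have er (A : 'M[R]_n.+1) j : ratio (neville A)^T j = ratio A^T j.
  by rewrite /ratio ![(neville A)^T _ _]mxE ![A^T _ _]mxE !neville_row0.
have er' : ratio (neville M^T)^T =1 ratio M by move=> i; rewrite er trmxK.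
apply/matrixP=> i j; rewrite !mxE er er'; ring.
Qed.

(** For consecutive rows the elimination acts inside the submatrix, except on its first row, whose
    predecessor is not selected. *)
Lemma minor_neville_expand M r s (f g : 'I_r.+1 -> 'I_n.+1) :
  consecutive_from s f ->
  minor M f g = \det (\matrix_(k, y)
    (if k == ord0 then M (f k) (g y) else neville M (f k) (g y))).
Proof.
move=> cf; apply: (@det_bidiag _ (fun k => if k == ord0 then 0 else ratio M (f k))).
split=> [|k y]; rewrite ?eqxx // !mxE; case: eqVneq => [_|k0].
  by rewrite mul0r addr0.
have -> : f (ordp k) = ordp (f k).
  by apply/val_inj; rewrite /= val_ordp !cf val_ordp; move: k0; rewrite -val_eqE /=; lia.
by rewrite subrK.
Qed.

Lemma minor_neville M r s (f g : 'I_r.+1 -> 'I_n.+1) :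
  consecutive_from s f ->
  (forall k, neville M (f ord0) (g k) = M (f ord0) (g k)) ->
  minor (neville M) f g = minor M f g.
Proof.
move=> cf eq0; rewrite (minor_neville_expand M _ cf); congr (\det _).
apply/matrixP=> k y; rewrite [LHS]mxE [RHS]mxE.
by have [->|] := eqVneq k ord0; first exact: eq0.
Qed.

(** After elimination inside the submatrix, its first column has a single entry left, at the top. *)
Lemma minor_neville_col0 p M r s (f g : 'I_r.+1 -> 'I_n.+1) :
  first_col_positive p M -> increasing f ->
  consecutive_from s f -> g ord0 = ord0 ->
  minor M f g = M (f ord0) ord0 *
    minor (neville M) (f \o lift ord0) (g \o lift ord0).
Proof.
move=> Mp incf cf g0; rewrite (minor_neville_expand _ _ cf) det_first_col.
  rewrite mxE eqxx g0; congr (_ * \det _).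
  by apply/matrixP=> k y; rewrite 2!mxE [RHS]mxE.
move=> k k0; rewrite mxE (negPf k0) g0 (neville_col0 Mp) //.
have : (f ord0 < f k)%N by apply: incf; move: k0; rewrite -val_eqE /=; lia.
by rewrite -val_eqE /=; lia.
Qed.

End NevilleStep.

(** * Splitting off the first index of a sequence *)

Definition cons_index n r (a : 'I_n.+1) (f : 'I_r -> 'I_n) (k : 'I_r.+1) : 'I_n.+1 :=
  if unlift ord0 k is Some k' then lift ord0 (f k') else a.

Lemma cons_index0 n r (a : 'I_n.+1) (f : 'I_r -> 'I_n) : cons_index a f ord0 = a.
Proof. by rewrite /cons_index unlift_none. Qed.

Lemma cons_indexS n r (a : 'I_n.+1) (f : 'I_r -> 'I_n) k :
  cons_index a f (lift ord0 k) = lift ord0 (f k).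
Proof. by rewrite /cons_index liftK. Qed.

Lemma increasing_neq0 n r (f : 'I_r.+1 -> 'I_n.+1) k :
  increasing f -> f ord0 != ord0 -> f k != ord0.
Proof.
move=> incf; have := increasing_le incf (leq0n k : (@ord0 r <= k)%N).
by rewrite -!val_eqE /=; lia.
Qed.

Lemma index_lift n r (f : 'I_r -> 'I_n.+1) :
  (forall k, f k != ord0) -> exists f' : 'I_r -> 'I_n, f =1 lift ord0 \o f'.
Proof.
move=> f0; suff /fin_all_exists : forall k, exists i, f k = lift ord0 i by [].
by move=> k; case: (unliftP ord0 (f k)) (f0 k) => [i ->|->]; [exists i | rewrite eqxx].
Qed.

Lemma index_cons n r (f : 'I_r.+1 -> 'I_n.+1) :
  increasing f ->
  exists2 f' : 'I_r -> 'I_n, increasing f' & f =1 cons_index (f ord0) f'.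
Proof.
move=> incf; have [k|f' ef] := @index_lift n r (f \o lift ord0).
  have : (f ord0 < f (lift ord0 k))%N by exact: incf.
  by rewrite -val_eqE /=; lia.
exists f' => [k l kl|k].
  have := ef k; have := ef l => /= el ek.
  have : (f (lift ord0 k) < f (lift ord0 l))%N by apply: incf; rewrite !lift0.
  by rewrite el ek !lift0.
case: (unliftP ord0 k) => [k'|] ->; last by rewrite cons_index0.
by rewrite cons_indexS; apply: ef.
Qed.

(** * The smaller matrix left by elimination, and its minors *)

Section Corner.
Variables (n p q : nat) (T : 'M[R]_n.+1).
Hypotheses (bT : banded p q T).
Hypotheses (Tp : first_col_positive p T) (Tq : first_col_positive q T^T).

Let T1 := neville T.
Let T2 := (neville T1^T)^T.
Definition corner : 'M[R]_n := mxsub (lift ord0) (lift ord0) T2.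

Let T1q : first_col_positive q T1^T.
Proof.
move=> i; suff -> : T1^T i ord0 = T^T i ord0 by exact: Tq.
by rewrite [LHS]mxE [RHS]mxE; apply: neville_row0.
Qed.

Lemma banded_corner : banded p q corner.
Proof.
have bT2 : banded p q T2.
  by apply/banded_tr/banded_neville => //; apply/banded_tr/banded_neville.
by move=> i j h; rewrite [LHS]mxE; apply: bT2; rewrite !lift0; lia.
Qed.

Let T2col i : i != ord0 -> T2 i ord0 = 0.
Proof. by move=> i0; rewrite /T2 mxE neville_row0 mxE (neville_col0 Tp). Qed.

Let T2row j : j != ord0 -> T2 ord0 j = 0.
Proof. by move=> j0; rewrite /T2 mxE (neville_col0 T1q). Qed.

Let T2_00 : T2 ord0 ord0 = T ord0 ord0.
Proof. by rewrite /T2 mxE neville_row0 mxE /T1 neville_row0. Qed.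

Lemma minor_corner r (f g : 'I_r -> 'I_n) :
  minor corner f g = minor T2 (lift ord0 \o f) (lift ord0 \o g).
Proof. by congr (\det _); apply/matrixP=> i j; rewrite !mxE. Qed.

Lemma minor_corner_cons r (f g : 'I_r -> 'I_n) :
  minor T2 (cons_index ord0 f) (cons_index ord0 g) = T ord0 ord0 * minor corner f g.
Proof.
rewrite /minor det_first_col => [|k k0]; last first.
  rewrite mxE cons_index0 T2col //; case: (unliftP ord0 k) k0 => [k'|] ->.
    by rewrite cons_indexS eq_sym neq_lift.
  by rewrite eqxx.
rewrite mxE !cons_index0 T2_00; congr (_ * \det _).
by apply/matrixP=> i j; rewrite [LHS]mxE [LHS]mxE !cons_indexS [RHS]mxE [RHS]mxE.
Qed.

(** Prefixing row [s] and column 0 gives an initial minor of [T], equal to the entry of [T] in row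
    [s] and column 0 times this minor. *)
Lemma corner_row_initial_gt0 r (f g : 'I_r.+1 -> 'I_n) s :
  nontrivial_initial_minors_pos p q T ->
  consecutive_from s f -> consecutive_from 0 g ->
  ~ trivial_minor p q f g -> 0 < minor corner f g.
Proof.
move=> Tpos cf cg ntr.
have sn : (s < n)%N by rewrite (leq_trans _ (ltn_ord (f ord0))) // cf addn0.
have sp : (s <= p)%N.
  rewrite leqNgt; apply/negP=> ps; apply: ntr; exists ord0; right.
  by rewrite cf cg !addn0.
have vs : (inord s : 'I_n.+1) = s :> nat by rewrite inordK // ltnW.
(* Row [k] of [corner] comes from row [k + 1] of [T], so prefixing [s] keeps the rows
   consecutive. *)
pose F := cons_index (inord s) f; pose G := cons_index ord0 g.
have cF : consecutive_from s F.
  move=> k; rewrite /F; case: (unliftP ord0 k) => [k'|] ->.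
    by rewrite cons_indexS !lift0 cf addnS.
  by rewrite cons_index0 vs addn0.
have cG : consecutive_from 0 G.
  move=> k; rewrite /G; case: (unliftP ord0 k) => [k'|] ->.
    by rewrite cons_indexS !lift0 cg.
  by rewrite cons_index0.
have incF : increasing F by move=> k l kl; rewrite !cF ltn_add2l.
have incG : increasing G by move=> k l kl; rewrite !cG ltn_add2l.
have : 0 < minor T F G.
  apply: Tpos => //; first by right; split=> //; exists s.
  by case=> k; rewrite cF cG; lia.
rewrite (minor_neville_col0 Tp incF cF) ?/G ?cons_index0 //.
rewrite pmulr_rgt0; last by apply: (Tp _).1; rewrite cF addn0.
congr (_ < _); rewrite minor_corner -[RHS]minor_tr trmxK.
(* Column elimination does not affect this minor: column 1 is reduced by column 0 of [T1], which is
   zero below its top entry. *)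
rewrite (@minor_neville _ _ _ 1) => [|k|k].
- by rewrite minor_tr; apply: eq_minor => k /=; rewrite /F cons_indexS.
- by rewrite lift0 cg.
rewrite mxE (_ : ordp _ = ord0); last first.
  by apply/val_inj; rewrite /= val_ordp /= /bump cg.
by rewrite [X in _ * X]mxE (neville_col0 Tp) ?mulr0 ?subr0 // eq_sym neq_lift.
Qed.

Lemma corner_minors_gt0 :
  nontrivial_minors_pos p q corner -> nontrivial_minors_pos p q T.
Proof.
move=> Spos.
have T00 : 0 < T ord0 ord0 by apply: (Tp _).1.
(* Size 0 is included because entries of [T] correspond to empty minors of [corner]. *)
have Spos0 r (f g : 'I_r -> 'I_n) : increasing f -> increasing g ->
    ~ trivial_minor p q f g -> 0 < minor corner f g.
  by case: r f g => [|r] f g incf incg ntr; rewrite ?minor_empty //; apply: Spos.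
have Sge0 r (f g : 'I_r -> 'I_n) : increasing f -> increasing g ->
    0 <= minor corner f g.
  move=> incf incg; have [tr|ntr] := boolP [exists k : 'I_r,
      (f k + q < g k)%N || (g k + p < f k)%N].
    rewrite (trivial_minor_eq0 banded_corner) //.
    by have /existsP[k /orP] := tr; exists k.
  apply/ltW/Spos0 => // -[k /orP h]; move/negP: ntr; apply; apply/existsP.
  by exists k.
(* [T2] is a direct sum: a minor using index 0 on one side only has a zero row or column. *)
have tT2 : totally_nonnegative T2.
  apply: totally_nonnegative_increasing => -[|r] f g incf incg.
    by rewrite minor_empty.
  have [f' incf' ef] := index_cons incf; have [g' incg' eg] := index_cons incg.
  have [f0|f0] := eqVneq (f ord0) ord0; have [g0|g0] := eqVneq (g ord0) ord0.
  - rewrite (eq_minor _ ef eg) f0 g0 minor_corner_cons mulr_ge0 ?Sge0 //.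
    exact: ltW.
  - rewrite /minor (expand_det_row _ ord0) big1 // => k _.
    by rewrite mxE f0 T2row ?mul0r // increasing_neq0.
  - rewrite /minor (expand_det_col _ ord0) big1 // => k _.
    by rewrite mxE g0 T2col ?mul0r // increasing_neq0.
  - have [F eF] := index_lift (fun k => increasing_neq0 k incf f0).
    have [G eG] := index_lift (fun k => increasing_neq0 k incg g0).
    rewrite (eq_minor _ eF eG) -minor_corner Sge0 // => k l.
      by move=> /incf; rewrite !eF !lift0.
    by move=> /incg; rewrite !eG !lift0.
have tT2' : totally_nonnegative (neville T1^T).
  by rewrite -[neville _]trmxK; apply: totally_nonnegative_tr.
have tT1 : totally_nonnegative T1.
  rewrite -[T1]trmxK; apply: totally_nonnegative_tr.
  apply: (bidiag_totally_nonnegative (bidiag_neville T1^T)).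
    by move=> i; apply: ratio_ge0 T1q.
  exact: tT2'.
have r1_ge0 i : 0 <= ratio T i by apply: ratio_ge0 Tp.
have r2_ge0 i : 0 <= ratio T1^T i by apply: ratio_ge0 T1q.
have le1 r (f g : 'I_r -> 'I_n.+1) : increasing f -> increasing g ->
    minor T1 f g <= minor T f g.
  exact: (minor_bidiag_le (bidiag_neville T)).
have le2 r (f g : 'I_r -> 'I_n.+1) : increasing f -> increasing g ->
    minor T2 f g <= minor T1 f g.
  move=> incf incg; rewrite /T2 minor_tr -(minor_tr T1).
  exact: (minor_bidiag_le (bidiag_neville T1^T)).
case=> // r f g _ incf incg ntr.
have [f' incf' ef] := index_cons incf; have [g' incg' eg] := index_cons incg.
have ntr' : ~ trivial_minor p q f' g'.
  case=> k h; apply: ntr; exists (lift ord0 k).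
  by rewrite ef eg !cons_indexS !lift0; lia.
have updE h (h' : 'I_r -> 'I_n) : h =1 cons_index (h ord0) h' ->
    upd h ord0 ord0 =1 cons_index ord0 h'.
  move=> eh k; rewrite /upd; case: (unliftP ord0 k) => [k'|] ->.
    by rewrite eq_sym (negPf (neq_lift _ _)) eh !cons_indexS.
  by rewrite eqxx cons_index0.
have N_gt0 : 0 < minor T2 (cons_index ord0 f') (cons_index ord0 g').
  by rewrite minor_corner_cons mulr_gt0 // Spos0.
(* When one of the two first indices is 0, this keeps the descent of the other within the positive
   multipliers. *)
have bound : (g ord0 <= f ord0 + q)%N /\ (f ord0 <= g ord0 + p)%N.
  by split; rewrite leqNgt; apply/negP=> h; apply: ntr; exists ord0; [left|right].
(* Here the column index descends, on the way from [T2] to [T1]. *)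
have [f0|f0] := eqVneq (f ord0) ord0.
  apply: lt_le_trans (le1 _ _ _ incf incg).
  rewrite -minor_tr; apply: (minor_bidiag_gt0 (bidiag_neville T1^T)) => //.
    move=> i /andP[i0 ig]; apply: (ratio_gt0 T1q); rewrite i0.
    by apply: leq_trans ig _; move: bound.1; rewrite f0.
  by rewrite (eq_minor _ (updE _ _ eg) ef) f0 -[neville _]trmxK minor_tr.
(* Here the row index descends, on the way from [T1] to [T]. *)
have [g0|g0] := eqVneq (g ord0) ord0.
  apply: (minor_bidiag_gt0 (bidiag_neville T)) => //.
    move=> i /andP[i0 ig]; apply: (ratio_gt0 Tp); rewrite i0.
    by apply: leq_trans ig _; move: bound.2; rewrite g0.
  apply: lt_le_trans (le2 _ _ _ _ incg); last exact: increasing_upd_first.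
  by rewrite (eq_minor _ (updE _ _ ef) eg) g0.
apply: lt_le_trans (le1 _ _ _ incf incg); apply: lt_le_trans (le2 _ _ _ incf incg).
have [F eF] := index_lift (fun k => increasing_neq0 k incf f0).
have [G eG] := index_lift (fun k => increasing_neq0 k incg g0).
rewrite (eq_minor _ eF eG) -minor_corner Spos0 // => [k l|k l|[k h]].
- by move=> /incf; rewrite !eF !lift0.
- by move=> /incg; rewrite !eG !lift0.
- by apply: ntr; exists k; rewrite eF eG !lift0; lia.
Qed.

End Corner.

(** * Transposition symmetry and induction on the size *)

Lemma corner_tr n (T : 'M[R]_n.+1) : corner T^T = (corner T)^T.
Proof.
by rewrite /corner -neville_tr_comm; apply/matrixP=> i j; rewrite !mxE.
Qed.

Lemma initial_minors_tr n p q (T : 'M[R]_n) :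
  nontrivial_initial_minors_pos p q T -> nontrivial_initial_minors_pos q p T^T.
Proof.
move=> Tpos r f g r0 incf incg ini ntr; rewrite minor_tr; apply: Tpos => //.
  by case: ini => -[? ?]; [right|left].
by move/trivial_minor_sym.
Qed.

(** First-column entries are initial minors of size 1, nontrivial exactly down to row [p]. *)
Lemma initial_first_col n p q (T : 'M[R]_n.+1) :
  banded p q T -> nontrivial_initial_minors_pos p q T -> first_col_positive p T.
Proof.
move=> bT Tpos i; split=> [ip|pi]; last by apply: bT; right.
have := Tpos 1 (fun=> i) (fun=> ord0) isT; rewrite /minor det_mx11 mxE; apply.
- by move=> k l; rewrite !ord1.
- by move=> k l; rewrite !ord1.
- by right; split; [exists i|] => k; rewrite ord1 ?addn0.
- by case=> k /=; lia.
Qed.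

Lemma corner_initial n p q (T : 'M[R]_n.+1) :
  banded p q T -> nontrivial_initial_minors_pos p q T ->
  nontrivial_initial_minors_pos p q (corner T).
Proof.
move=> bT Tpos; have Tp := initial_first_col bT Tpos.
have bT' := banded_tr bT; have Tpos' := initial_minors_tr Tpos.
have Tq := initial_first_col bT' Tpos'.
case=> // r f g _ _ _ [[cf [s cg]]|[[s cf] cg]] ntr.
  (* Minors on the first rows reduce to minors on the first columns of [corner T^T]. *)
  rewrite -minor_tr -corner_tr.
  apply: (corner_row_initial_gt0 Tq Tpos' cg cf) => /trivial_minor_sym //.
exact: (corner_row_initial_gt0 Tp Tpos cf cg).
Qed.

Lemma initial_minors_nontrivial_minors n p q (T : 'M[R]_n) :
  banded p q T -> nontrivial_initial_minors_pos p q T ->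
  nontrivial_minors_pos p q T.
Proof.
elim: n T => [|n IHn] T bT Tpos; first by case=> // r f; case: (f ord0).
have Tp := initial_first_col bT Tpos.
have Tq := initial_first_col (banded_tr bT) (initial_minors_tr Tpos).
apply: (corner_minors_gt0 bT Tp Tq); apply: IHn; last exact: corner_initial.
exact: banded_corner.
Qed.

End Minors.

Theorem theorem2p15 (R : realType) (n p q : nat) (T : 'M[R]_n)
    (hp : (p <= n)%N) (hq : (q <= n)%N) (hT : banded p q T) :
  banded_totally_positive p q T <-> nontrivial_initial_minors_pos p q T.
Proof.
split=> [[_ Tpos] r f g r0 incf incg _|Tpos]; first exact: Tpos.
by split=> //; apply: initial_minors_nontrivial_minors.
Qed.
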